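(* Let $n\ge 4$ and let $\mathbf z=(z_\alpha)_{\alpha\in I_n}$ be a Heronian frieze of order $n$ such that $z_{(i,j)}\neq 0$ for every $(i,j)\in\mathbb Z^2$ with $2\le j-i\le n-2$. Then $\mathbf z$ possesses the glide symmetry $$z_{(i,j)}=z_{(j,\,i+n)}\qquad\text{for all }(i,j)\in N_n .$$
   Context: For complex $p,q,r$ put $H(p,q,r)=-p^2-q^2-r^2+2pq+2pr+2qr$. A Heronian diamond is an ordered 10-tuple $(a,b,c,d,e,f,p,q,r,s)$ of complex numbers satisfying $p^2=H(b,c,e)$, $q^2=H(a,d,e)$, $r^2=H(a,f,b)$, $s^2=H(c,f,d)$, $r+s=p+q$, $4ef=(p+q)^2+(a-b+c-d)^2$, and $e(r-s)=p(a-d)+q(b-c)$. Index sets, for $n\ge4$: $N_n=\{(i,j)\in(\mathbb Z\times\frac12\mathbb Z)\cup(\frac12\mathbb Z\times\mathbb Z): 0\le j-i\le n\}$ (nodes); $L_n=\{(i+\frac12,/): i\in\mathbb Z\}\cup\{(\backslash,j+\frac12): j\in\mathbb Z\}$ (formal indices called lines); $I_n=N_n\sqcup L_n$. A Heronian frieze of order $n$ is an array $\mathbf z=(z_\alpha)_{\alpha\in I_n}$ of complex numbers such that (1) for every $(i,j)\in\mathbb Z^2$ with $1\le j-i\le n-1$ the 10-tuple $$(z_{(i,j+1)}, z_{(i+\frac12,/)}, z_{(i+1,j)}, z_{(\backslash,j+\frac12)}, z_{(i,j)}, z_{(i+1,j+1)}, z_{(i+\frac12,j)}, z_{(i,j+\frac12)},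 z_{(i+\frac12,j+1)}, z_{(i+1,j+\frac12)})$$ is a Heronian diamond (in the order $(a,b,c,d,e,f,p,q,r,s)$); and (2) $z_{(i,j)}=0$ for every $(i,j)\in N_n$ with $j-i\in\{0,\frac12,n-\frac12,n\}$. *)

(* Defs.v *)
From mathcomp Require Import all_boot all_order all_algebra.
From mathcomp Require Import reals complex.

Set Implicit Arguments.
Unset Strict Implicit.
Unset Printing Implicit Defensive.

Import Order.TTheory GRing.Theory Num.Theory.
Local Open Scope ring_scope.

Definition heron (R : realType) (p q r : R[i]) : R[i] :=
  - p ^+ 2 - q ^+ 2 - r ^+ 2 + 2 * p * q + 2 * p * r + 2 * q * r.

Record heronian_diamond (R : realType) (a b c d e f p q r s : R[i]) : Prop :=
  HeronianDiamond {
    diamond_p : p ^+ 2 = heron b c e;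
    diamond_q : q ^+ 2 = heron a d e;
    diamond_r : r ^+ 2 = heron a f b;
    diamond_s : s ^+ 2 = heron c f d;
    diamond_add : r + s = p + q;
    diamond_ef : 4 * e * f = (p + q) ^+ 2 + (a - b + c - d) ^+ 2;
    diamond_sub : e * (r - s) = p * (a - d) + q * (b - c)
  }.

Definition one_half : rat := 2^-1.

Definition is_node (n : nat) (i j : rat) : bool :=
  ((i \is a Num.int) && (2 * j \is a Num.int)
   || (2 * i \is a Num.int) && (j \is a Num.int))
  && (0 <= j - i <= n%:R).

(* [Node i j] belongs to I_n only when [is_node n i j]; [Slash i] is the line
   (i + 1/2, /) and [Backslash j] is the line (\, j + 1/2). An array indexed by
   I_n is represented by a total function on [frieze_index] whose values at the
   remaining [Node i j] are never constrained nor read. *)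
Inductive frieze_index : Type :=
  | Node of rat & rat
  | Slash of int
  | Backslash of int.

Record heronian_frieze (R : realType) (n : nat) (z : frieze_index -> R[i]) : Prop :=
  HeronianFrieze {
    frieze_diamond : forall i j : int, 1 <= j - i <= n%:Z - 1 ->
      heronian_diamond
        (z (Node i%:Q (j%:Q + 1)))
        (z (Slash i))
        (z (Node (i%:Q + 1) j%:Q))
        (z (Backslash j))
        (z (Node i%:Q j%:Q))
        (z (Node (i%:Q + 1) (j%:Q + 1)))
        (z (Node (i%:Q + one_half) j%:Q))
        (z (Node i%:Q (j%:Q + one_half)))
        (z (Node (i%:Q + one_half) (j%:Q + 1)))
        (z (Node (i%:Q + 1) (j%:Q + one_half)));
    frieze_boundary : forall i j : rat, is_node n i j ->
      j - i \in [:: 0; one_half; n%:R - one_half; n%:R] -> z (Node i j) = 0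
  }.

(* Main.v *)
(* The frieze is realised by a closed n-gon A in the complex quadratic plane:
   integer nodes are squared distances, half-integer nodes are (4 times) signed
   areas of triangles. In isotropic coordinates the quadratic form is u * v, so
   a point at nonzero squared distance from the origin and the squared sides and
   area of a triangle on it determine the third vertex rationally; the first row
   of the frieze thus yields the polygon. A diamond with e <> 0 determines
   (f, r, s) from the other entries, and quadrilaterals give diamonds, so every
   later row is the one read off from A, extended n-periodically. The glide
   symmetry is then the symmetry of distances and areas. *)
Require Import Defs.
From mathcomp Require Import all_boot all_order all_algebra.
From mathcomp Require Import reals complex.
From mathcomp Require Import zify ring lra.

Set Implicit Arguments.
Unset Strict Implicit.
Unset Printing Implicit Defensive.

Import Order.TTheory GRing.Theory Num.Theory.
Local Open Scope ring_scope.

(** * Squared distances and areas in the complex plane *)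

(* Points are given in isotropic coordinates. *)
Definition sqdist (K : numClosedFieldType) (x y : K * K) : K :=
  (x.1 - y.1) * (x.2 - y.2).

(** For isotropic coordinates [s - 'i * t] and [s + 'i * t] this is four times the usual signed
    area. *)
Definition area (K : numClosedFieldType) (x y w : K * K) : K :=
  - 'i * ((y.1 - x.1) * (w.2 - x.2) - (w.1 - x.1) * (y.2 - x.2)).

Lemma sqdistC (K : numClosedFieldType) (x y : K * K) : sqdist x y = sqdist y x.
Proof. by rewrite /sqdist; ring. Qed.

Lemma sqdistxx (K : numClosedFieldType) (x : K * K) : sqdist x x = 0.
Proof. by rewrite /sqdist; ring. Qed.

Lemma area_rot (K : numClosedFieldType) (x y w : K * K) :
  area x y w = area y w x.
Proof. by rewrite /area; ring. Qed.

Lemma areaxx (K : numClosedFieldType) (x y : K * K) : area x x y = 0.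
Proof. by rewrite /area; ring. Qed.

Lemma area_swap (K : numClosedFieldType) (x y w : K * K) :
  area x y w = - area x w y.
Proof. by rewrite /area; ring. Qed.

(** Both sides cut the quadrilateral [x y z w] along a diagonal. This and the next two identities
    give the last three diamond relations, with [e] and [f] the squared diagonals. *)
Lemma quadrilateral_add (K : numClosedFieldType) (x y z w : K * K) :
  area x y w + area y z w = area x y z + area x z w.
Proof. by rewrite /area; ring. Qed.

(** Bretschneider's formula. *)
Lemma quadrilateral_diagonals (K : numClosedFieldType) (x y z w : K * K) :
  4 * sqdist x z * sqdist y w =
  (area x y z + area x z w) ^+ 2
  + (sqdist x w - sqdist x y + sqdist y z - sqdist z w) ^+ 2.
Proof.
by rewrite /area -mulrDr exprMn sqrrN sqrCi /sqdist; ring.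
Qed.

Lemma quadrilateral_sub (K : numClosedFieldType) (x y z w : K * K) :
  sqdist x z * (area x y w - area y z w) =
  area x y z * (sqdist x w - sqdist z w)
  + area x z w * (sqdist x y - sqdist y z).
Proof. by rewrite /area /sqdist; ring. Qed.

(** * Solving triangles and diamonds *)

Lemma heron0 (R : realType) (x y p : R[i]) :
  p = 0 -> p ^+ 2 = heron 0 x y -> x = y.
Proof.
move=> -> /esym; rewrite /heron => h.
have : (x - y) ^+ 2 = - 0 ^+ 2 by rewrite -h; ring.
by rewrite expr0n oppr0 => /eqP; rewrite sqrf_eq0 subr_eq0 => /eqP.
Qed.

Lemma heronC12 (R : realType) (x y w : R[i]) : heron x y w = heron y x w.
Proof. by rewrite /heron; ring. Qed.

Lemma heronC23 (R : realType) (x y w : R[i]) : heron x y w = heron x w y.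
Proof. by rewrite /heron; ring. Qed.

(** For [x = (u, v)] and [y = (s, t)], the last two conditions, given [s * t = a], are linear in
    [s * v] and [u * t]. Solving them leaves [s * t = a], which is exactly the Heron relation. *)
Lemma exists_third_vertex (R : realType) (x : R[i] * R[i]) (a d q : R[i]) :
  sqdist 0 x != 0 -> q ^+ 2 = heron a d (sqdist 0 x) ->
  exists y : R[i] * R[i],
    [/\ sqdist 0 y = a, sqdist x y = d & area 0 x y = q].
Proof.
case: x => u v; rewrite /sqdist /area /heron /= !sub0r mulrNN => e0 hq.
have [u0 v0] : u != 0 /\ v != 0.
  by move: e0; rewrite mulf_eq0 negb_or => /andP.
set w : R[i] := 'i; have hw : w ^+ 2 = -1 by exact: sqrCi.
pose m := a + u * v - d.
have hm : (m - w * q) * (m + w * q) = 4 * a * (u * v).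
  have -> : (m - w * q) * (m + w * q) = m ^+ 2 - w ^+ 2 * q ^+ 2 by ring.
  by rewrite hw hq /m; ring.
exists ((m - w * q) / (2 * v), (m + w * q) / (2 * u)) => /=.
have ha : (m - w * q) / (2 * v) * ((m + w * q) / (2 * u)) = a.
  have -> : (m - w * q) / (2 * v) * ((m + w * q) / (2 * u))
     = (m - w * q) * (m + w * q) / (4 * (u * v)) by field; rewrite u0 v0.
  by rewrite hm; field; rewrite u0 v0.
split; first by rewrite !sub0r mulrNN.
  rewrite mulrBl !mulrBr ha /m; field; by rewrite u0 v0.
have -> : - w * ((u - 0) * ((m + w * q) / (2 * u) - 0)
   - ((m - w * q) / (2 * v) - 0) * (v - 0)) = - w ^+ 2 * q.
  by field; rewrite u0 v0.
by rewrite hw opprK mul1r.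
Qed.

Lemma diamond_determined (R : realType)
    (a b c d e f p q r s f' r' s' : R[i]) :
  e != 0 -> heronian_diamond a b c d e f p q r s ->
  r' + s' = p + q ->
  4 * e * f' = (p + q) ^+ 2 + (a - b + c - d) ^+ 2 ->
  e * (r' - s') = p * (a - d) + q * (b - c) ->
  [/\ f = f', r = r' & s = s'].
Proof.
move=> e0 [_ _ _ _ hadd hef hsub] hadd' hef' hsub'.
have two0 : (2 : R[i]) != 0 by rewrite pnatr_eq0.
have e40 : 4 * e != 0 by rewrite mulf_neq0 ?pnatr_eq0.
have hd : r - s = r' - s' by apply: (mulfI e0); rewrite hsub hsub'.
have hr : r = r'.
  apply: (mulfI two0); rewrite (_ : 2 * r = (r + s) + (r - s)); last by ring.
  by rewrite hadd -hadd' hd; ring.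
split=> //; first by apply: (mulfI e40); rewrite hef hef'.
by apply: (addrI r); rewrite hadd -hadd' hr.
Qed.

(** * Friezes with natural indices and their realisation row by row *)

(* [X i j], [P i j] and [Q i j] stand for the entries at the nodes [(i, j)],
   [(i + 1/2, j)] and [(i, j + 1/2)], and [B i] and [D j] for those at the lines
   [(i + 1/2, /)] and [(\, j + 1/2)]. *)
Record nat_frieze (R : realType) (n : nat) (X P Q : nat -> nat -> R[i])
    (B D : nat -> R[i]) : Prop := NatFrieze {
  nat_diamond : forall i j, (i < j < i + n)%N ->
    heronian_diamond (X i j.+1) (B i) (X i.+1 j) (D j) (X i j) (X i.+1 j.+1)
      (P i j) (Q i j) (P i j.+1) (Q i.+1 j);
  nat_X0 : forall i, X i i = 0;
  nat_Xn : forall i, X i (i + n)%N = 0;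
  nat_P0 : forall i, P i i.+1 = 0;
  nat_Pn : forall i, P i (i + n)%N = 0;
  nat_Q0 : forall i, Q i i = 0;
  nat_Qn : forall i, Q i (i + n).-1 = 0;
  nat_neq0 : forall i j, (i.+2 <= j)%N -> (j.+2 <= i + n)%N -> X i j != 0
}.

(** These entries enter the diamonds of row [i] from one side. [P] is absent because [P i] lies
    between rows [i] and [i.+1] and is found in passing from one to the other. *)
Record polygon_row (R : realType) (n : nat) (X Q : nat -> nat -> R[i])
    (D : nat -> R[i]) (A : nat -> R[i] * R[i]) (i : nat) : Prop := PolygonRow {
  row_X : forall j, (i <= j <= i + n)%N -> X i j = sqdist (A i) (A j);
  row_Q : forall j, (i <= j < i + n)%N -> Q i j = area (A i) (A j) (A j.+1);
  row_D : forall j, (i < j < i + n)%N -> D j = sqdist (A j) (A j.+1)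
}.

Section NatFrieze.

Context (R : realType) (n : nat) (X P Q : nat -> nat -> R[i]).
Context (B D : nat -> R[i]).
Context (n_ge4 : (4 <= n)%N) (F : nat_frieze n X P Q B D).

(** Here and in the next three lemmas, a border diamond has a vanishing area and a vanishing side,
    so [heron0] identifies two entries. *)
Lemma left_line i : B i = X i i.+1.
Proof.
have := nat_diamond F (i := i) (j := i.+1) ltac:(lia); move/diamond_p.
by rewrite (nat_X0 F) heronC12; apply: heron0; rewrite (nat_P0 F).
Qed.

Lemma right_line_top i : D (i + n).-1 = X i (i + n).-1.
Proof.
have := nat_diamond F (i := i) (j := (i + n).-1) ltac:(lia).
rewrite prednK ?(nat_Xn F); last by lia.
by move/diamond_q; apply: heron0; rewrite (nat_Qn F).
Qed.

Lemma next_side i : X i.+1 i.+2 = D i.+1.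
Proof.
have := nat_diamond F (i := i) (j := i.+1) ltac:(lia).
move/diamond_s; rewrite (nat_X0 F); apply: heron0.
by rewrite (nat_Q0 F).
Qed.

Lemma long_diagonal i : X i.+1 (i + n)%N = B i.
Proof.
have := nat_diamond F (i := i) (j := (i + n).-1) ltac:(lia).
rewrite prednK ?(nat_Xn F); last by lia.
by move/diamond_r; apply: heron0; rewrite (nat_Pn F).
Qed.

Lemma polygon_row_step (A : nat -> R[i] * R[i]) i :
  (forall k, A (k + n)%N = A k) -> polygon_row n X Q D A i ->
  polygon_row n X Q D A i.+1
  /\ forall j, (i < j <= i + n)%N -> P i j = area (A i) (A i.+1) (A j).
Proof.
move=> Aper [hX hQ hD].
have hB : B i = sqdist (A i) (A i.+1) by rewrite left_line hX //; lia.
(* Five claims go together because the entries [f] and [r] of one diamond are [c] and [p] of the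
   next one in the row. *)
have step k : (k.+2 <= n)%N ->
    [/\ X i.+1 (i + k.+1)%N = sqdist (A i.+1) (A (i + k.+1)%N),
        P i (i + k.+1)%N = area (A i) (A i.+1) (A (i + k.+1)%N),
        X i.+1 (i + k.+2)%N = sqdist (A i.+1) (A (i + k.+2)%N),
        P i (i + k.+2)%N = area (A i) (A i.+1) (A (i + k.+2)%N) &
        Q i.+1 (i + k.+1)%N
          = area (A i.+1) (A (i + k.+1)%N) (A (i + k.+2)%N)].
  elim: k => [_|k IHk k_lt].
    (* In the first diamond [e] is the side [X i i.+1], which may be 0; boundary zeros replace
       division by [e]. *)
    have P0 : P i i.+1 = 0 := nat_P0 F i.
    have Q0 : Q i.+1 i.+1 = 0 := nat_Q0 F i.+1.
    rewrite !addnS !addn0 (nat_X0 F) sqdistxx P0 Q0 areaxx.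
    rewrite [area (A i) (A i.+1) (A i.+1)]area_rot areaxx.
    rewrite next_side hD; last by lia.
    split=> //.
    have /diamond_add := nat_diamond F (i := i) (j := i.+1) ltac:(lia).
    by rewrite P0 Q0 addr0 add0r => ->; rewrite hQ //; lia.
  have [_ _ hc hp _] := IHk (ltnW k_lt).
  set j := (i + k.+2)%N in hc hp *.
  have -> : (i + k.+3)%N = j.+1 by rewrite /j; lia.
  have dia := nat_diamond F (i := i) (j := j) ltac:(lia).
  (* The last diamond, [j = i + n - 1], again has a side as [e], and the polygon closes up there. *)
  have [j_last|j_int] := eqVneq k.+3 n.
    have jn : j.+1 = (i + n)%N by rewrite /j -j_last; lia.
    have hr : P i j.+1 = 0 by rewrite jn (nat_Pn F).
    have Aj : A j.+1 = A i by rewrite jn.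
    split=> //.
    - by rewrite jn long_diagonal hB Aper sqdistC.
    - by rewrite hr Aj 2!area_rot areaxx.
    - have /diamond_add := dia; rewrite hr hp add0r => ->.
      rewrite (_ : j = (i + n).-1); last by rewrite -jn.
      rewrite (nat_Qn F) addr0 -jn Aj; exact: area_rot.
  have e0 : X i j != 0 by apply: (nat_neq0 F); rewrite /j; lia.
  move: e0 dia; rewrite hX ?hX ?hQ ?hD ?hB ?hc ?hp; try by rewrite /j; lia.
  move=> e0 dia.
  have [-> -> ->] := diamond_determined e0 dia (quadrilateral_add _ _ _ _)
    (quadrilateral_diagonals _ _ _ _) (quadrilateral_sub _ _ _ _).
  by [].
have hP1 : P i i.+1 = area (A i) (A i.+1) (A i.+1).
  by rewrite (nat_P0 F) area_rot areaxx.
have An : A (i.+1 + n)%N = A i.+1 by [].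
split=> [|j /andP[ij jn]].
  split=> j.
  - move=> /andP[ij jn].
    have [->|ji] := eqVneq j i.+1; first by rewrite (nat_X0 F) sqdistxx.
    have [->|jin] := eqVneq j (i.+1 + n)%N.
      by rewrite (nat_Xn F) An sqdistxx.
    have -> : j = (i + (j - i.+2).+2)%N by lia.
    by have [|] := step (j - i.+2)%N; first lia.
  - move=> /andP[ij jn].
    have [->|jin] := eqVneq j (i.+1 + n).-1.
      by rewrite (nat_Qn F) prednK ?An 2?area_rot ?areaxx //; lia.
    have -> : (j = i + (j - i.+1).+1)%N by lia.
    rewrite -addnS.
    by have [|] := step (j - i.+1)%N; first lia.
  - move=> /andP[ij jn].
    (* Only the line [i + n] is new to the window; the border lemmas equate it with [B i]. *)
    have [->|jin] := eqVneq j (i.+1 + n).-1; last by apply: hD; lia.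
    by rewrite right_line_top /= long_diagonal hB -{1}Aper -An.
have [->//|ji] := eqVneq j i.+1.
have -> : (j = i + (j - i.+2).+2)%N by lia.
by have [|] := step (j - i.+2)%N; first lia.
Qed.

(** * The polygon of the first row and the glide *)

(* The construction starts at the vertex 2, because the side [X 0 1] may be 0. *)
Lemma polygon_prefix m : (2 <= m < n)%N ->
  exists A : nat -> R[i] * R[i],
    [/\ A 0%N = 0,
        forall j, (0 < j <= m)%N -> X 0%N j = sqdist 0 (A j) &
        forall j, (0 < j < m)%N ->
          D j = sqdist (A j) (A j.+1) /\ Q 0%N j = area 0 (A j) (A j.+1)].
Proof.
elim: m => [|[|[|m]] IHm] // /andP[_ m_lt].
  (* Any point at squared distance [X 0 2] from the origin can serve as vertex 2. *)
  pose x : R[i] * R[i] := (1, X 0%N 2%N).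
  have hx : sqdist 0 x = X 0%N 2%N by rewrite /sqdist /=; ring.
  have x0 : sqdist 0 x != 0 by rewrite hx; apply: (nat_neq0 F); lia.
  have := nat_diamond F (i := 0%N) (j := 1%N) ltac:(lia).
  (* Building vertex 1 from vertex 2 reverses the triangle, hence the sign of the area. *)
  move/diamond_q; rewrite -sqrrN heronC12 heronC23 heronC12 -hx.
  move/(exists_third_vertex x0) => [y [hy hd hq]].
  exists (fun j => if j == 0%N then 0 else if j == 1%N then y else x).
  split=> // [[|[|[|j]]]|[|[|j]]] //=.
  by rewrite area_swap hq opprK sqdistC hd.
have [|A [A0 hX hDQ]] := IHm; first by lia.
have hx : X 0%N m.+2 = sqdist 0 (A m.+2) by apply: hX; lia.
have x0 : sqdist 0 (A m.+2) != 0 by rewrite -hx; apply: (nat_neq0 F); lia.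
have := nat_diamond F (i := 0%N) (j := m.+2) ltac:(lia).
move/diamond_q; rewrite hx; move/(exists_third_vertex x0) => [y [hy hd hq]].
exists (fun j => if j == m.+3 then y else A j); split=> // j jm.
  by case: eqVneq => [->//|jm3]; apply: hX; lia.
rewrite eqSS; case: (eqVneq j m.+3) => [|_]; first by lia.
by case: eqVneq => [->//|jm2]; apply: hDQ; lia.
Qed.

(** A prefix up to [n.-1] already contains all vertices; the closing side and triangle agree with
    the border values. *)
Lemma polygon_row0 :
  exists2 A : nat -> R[i] * R[i],
    forall k, A (k + n)%N = A k & polygon_row n X Q D A 0.
Proof.
have [|A [A0 hX hDQ]] := @polygon_prefix n.-1; first by lia.
exists (fun k => A (k %% n)%N) => [k|]; first by rewrite modnDr.
have Xn : X 0%N n = 0 := nat_Xn F 0.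
have Qn : Q 0%N n.-1 = 0 := nat_Qn F 0.
have n0 : (n.-1.+1 %% n = 0)%N by rewrite prednK ?modnn; lia.
have small j : (j < n)%N -> (j %% n = j)%N by exact: modn_small.
split=> j /andP[j0 jn]; rewrite ?mod0n ?A0.
- have [->|j0'] := eqVneq j 0%N; first by rewrite mod0n A0 (nat_X0 F) sqdistxx.
  have [->|jn'] := eqVneq j n; first by rewrite modnn A0 Xn sqdistxx.
  by rewrite small ?hX //; lia.
- have [->|j0'] := eqVneq j 0%N; first by rewrite mod0n A0 (nat_Q0 F) areaxx.
  have [->|jn'] := eqVneq j n.-1.
    by rewrite n0 A0 Qn 2!area_rot areaxx.
  by rewrite !small; [have [_ ->] := hDQ j ltac:(lia) | lia | lia].
- have [->|jn'] := eqVneq j n.-1.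
    have top := right_line_top 0; rewrite add0n in top.
    by rewrite n0 A0 top sqdistC small ?hX //; lia.
  by rewrite !small; [have [-> _] := hDQ j ltac:(lia) | lia | lia].
Qed.

(** Since [A n = A 0] and [A n.+1 = A 1], each equality compares the same two or three vertices, in
    swapped or cyclically rotated order. *)
Lemma nat_glide :
  [/\ forall l, (l <= n)%N -> X 0%N l = X l n,
      forall l, (l < n)%N -> Q 0%N l = P l n &
      forall l, (0 < l <= n)%N -> P 0%N l = Q l n].
Proof.
have [A Aper row0] := polygon_row0.
have row i : polygon_row n X Q D A i.
  by elim: i => // i /(polygon_row_step Aper)[].
have An : A n = A 0%N := Aper 0%N.
have An1 : A n.+1 = A 1%N := Aper 1%N.
split=> l ln.
- by rewrite (row_X (row 0%N)) ?(row_X (row l)) ?An 1?sqdistC //; lia.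
- have [_ ->] := polygon_row_step Aper (row l); last by lia.
  by rewrite (row_Q (row 0%N)) ?An 1?area_rot //; lia.
- have [_ ->] := polygon_row_step Aper (row 0%N); last by lia.
  by rewrite (row_Q (row l)) ?An ?An1 2?area_rot //; lia.
Qed.

End NatFrieze.

(** * Rational nodes and the passage to natural indices *)

Lemma is_node_int (n : nat) (i j : int) :
  0 <= j - i <= n%:Z -> is_node n i%:Q j%:Q.
Proof.
move=> ij; rewrite /is_node -[2]/(2%:Q) -!rmorphM !intr_int /=.
by rewrite -intrB -[n%:R]/(n%:Z%:Q) (ler_int _ 0) ler_int.
Qed.

Lemma is_node_left_half (n : nat) (i j : int) :
  0 < j - i <= n%:Z -> is_node n (i%:Q + one_half) j%:Q.
Proof.
move=> ij; have E : 2 * (i%:Q + one_half) = (2 * i + 1)%:Q.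
  by rewrite intrD intrM /one_half; field.
rewrite /is_node E !intr_int orbT /=.
have : (1 <= (j - i)%:Q <= n%:Z%:Q) by rewrite (ler_int _ 1) ler_int; lia.
by rewrite intrB /one_half -[n%:Z%:Q]/(n%:R); lra.
Qed.

Lemma is_node_right_half (n : nat) (i j : int) :
  0 <= j - i < n%:Z -> is_node n i%:Q (j%:Q + one_half).
Proof.
move=> ij; have E : 2 * (j%:Q + one_half) = (2 * j + 1)%:Q.
  by rewrite intrD intrM /one_half; field.
rewrite /is_node E !intr_int /=.
have : (0 <= (j - i)%:Q <= (n%:Z - 1)%:Q) by rewrite (ler_int _ 0) ler_int; lia.
by rewrite !intrB /one_half -[n%:Z%:Q]/(n%:R); lra.
Qed.

Variant node_spec (n : nat) : rat -> rat -> Prop :=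
  | NodeInt (i j : int) of 0 <= j - i <= n%:Z : node_spec n i%:Q j%:Q
  | NodeLeftHalf (i j : int) of 0 < j - i <= n%:Z :
      node_spec n (i%:Q + one_half) j%:Q
  | NodeRightHalf (i j : int) of 0 <= j - i < n%:Z :
      node_spec n i%:Q (j%:Q + one_half).

Lemma half_int (x : rat) : 2 * x \is a Num.int ->
  exists k : int, x = k%:Q \/ x = k%:Q + one_half.
Proof.
move=> /intrP[m xm]; exists (m %/ 2)%Z.
have -> : x = m%:Q / 2 by rewrite -xm mulrC mulKf.
have [m2|m2] : (m = (m %/ 2)%Z * 2 \/ m = (m %/ 2)%Z * 2 + 1) by lia.
- by left; rewrite {1}m2 intrM mulfK.
- by right; rewrite {1}m2 intrD intrM /one_half; field.
Qed.

Lemma nodeP (n : nat) (i j : rat) : is_node n i j -> node_spec n i j.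
Proof.
have int_case (a b : int) : 0 <= b%:Q - a%:Q <= n%:R -> node_spec n a%:Q b%:Q.
  rewrite -intrB -[n%:R]/(n%:Z%:Q) (ler_int _ 0) ler_int.
  exact: NodeInt.
case/andP => /orP[/andP[/intrP[a ->] /half_int[b [->|->]]] |
                  /andP[/half_int[a [->|->]] /intrP[b ->]]];
  [exact: int_case | | exact: int_case | ] => h.
- apply: NodeRightHalf.
  (* Doubling clears [one_half], so integrality makes the upper bound strict. *)
  have : 0 <= (2 * (b - a) + 1)%:Q <= (2 * n%:Z)%:Q.
    by move: h; rewrite intrD !intrM intrB -[n%:Z%:Q]/(n%:R) /one_half; lra.
  by rewrite (ler_int _ 0) ler_int; lia.
- apply: NodeLeftHalf.
  have : 0 <= (2 * (b - a) - 1)%:Q <= (2 * n%:Z)%:Q.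
    by move: h; rewrite intrB !intrM intrB -[n%:Z%:Q]/(n%:R) /one_half; lra.
  by rewrite (ler_int _ 0) ler_int; lia.
Qed.

(** An arbitrary origin [i0] makes induction over rows possible and reduces the glide at any node to
    row 0. *)
Lemma shifted_nat_frieze (R : realType) (n : nat) (z : frieze_index -> R[i])
    (i0 : int) :
  (4 <= n)%N -> heronian_frieze n z ->
  (forall i j : int, 2 <= j - i <= n%:Z - 2 -> z (Node i%:Q j%:Q) <> 0) ->
  nat_frieze n
    (fun i j => z (Node (i0 + i%:Z)%:Q (i0 + j%:Z)%:Q))
    (fun i j => z (Node ((i0 + i%:Z)%:Q + one_half) (i0 + j%:Z)%:Q))
    (fun i j => z (Node (i0 + i%:Z)%:Q ((i0 + j%:Z)%:Q + one_half)))
    (fun i => z (Slash (i0 + i%:Z))) (fun j => z (Backslash (i0 + j%:Z))).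
Proof.
move=> n4 [dia bnd] neq0.
have succ (k : nat) : (i0 + k.+1%:Z)%:Q = (i0 + k%:Z)%:Q + 1.
  by rewrite -[1]/(1%:Q) -intrD; congr (_%:Q); lia.
have addn (k : nat) : (i0 + (k + n)%N%:Z)%:Q = (i0 + k%:Z)%:Q + n%:R.
  by rewrite -[n%:R]/(n%:Z%:Q) -intrD; congr (_%:Q); lia.
split=> i.
- move=> j ij; rewrite !succ; apply: dia; lia.
- by apply: bnd; [apply: is_node_int; lia | rewrite subrr inE eqxx].
- apply: bnd; first by apply: is_node_int; lia.
  by rewrite addn addrAC subrr add0r !inE eqxx !orbT.
- apply: bnd; first by apply: is_node_left_half; lia.
  have -> : (i0 + i.+1%:Z)%:Q - ((i0 + i%:Z)%:Q + one_half) = one_half.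
    by rewrite succ /one_half; field.
  by rewrite !inE eqxx !orbT.
- apply: bnd; first by apply: is_node_left_half; lia.
  have -> : (i0 + (i + n)%N%:Z)%:Q - ((i0 + i%:Z)%:Q + one_half)
      = n%:R - one_half by rewrite addn; ring.
  by rewrite !inE eqxx !orbT.
- apply: bnd; first by apply: is_node_right_half; lia.
  by rewrite addrAC subrr add0r !inE eqxx !orbT.
- apply: bnd; first by apply: is_node_right_half; lia.
  have -> : (i0 + (i + n).-1%:Z)%:Q + one_half - (i0 + i%:Z)%:Q
      = n%:R - one_half.
    have -> : (i0 + (i + n).-1%:Z)%:Q = (i0 + (i + n)%N%:Z)%:Q - 1.
      by rewrite -[1]/(1%:Q) -intrB; congr (_%:Q); lia.
    by rewrite addn /one_half; field.
  by rewrite !inE eqxx !orbT.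
- by move=> j ij ji; apply/eqP/neq0; lia.
Qed.

Theorem theorem3p13 (R : realType) (n : nat) (z : frieze_index -> R[i])
    (n_ge4 : (4 <= n)%N) (z_frieze : heronian_frieze n z)
    (z_neq0 : forall i j : int, 2 <= j - i <= n%:Z - 2 ->
       z (Node i%:Q j%:Q) <> 0) :
  forall i j : rat, is_node n i j -> z (Node i j) = z (Node j (i + n%:R)).
Proof.
(* The origin is put at [i]; the glide exchanges the two kinds of half-integer nodes. *)
move=> _ _ /nodeP[] i j ij; pose l := `|j - i|%N;
  have [glideX glideQ glideP] :=
    nat_glide n_ge4 (shifted_nat_frieze i n_ge4 z_frieze z_neq0);
  have jE : j = i + l%:Z by (rewrite /l; lia).
- have := glideX l; rewrite -jE addr0 intrD; apply; lia.
- have := glideP l; rewrite -jE addr0 intrD addrAC; apply; lia.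
- have := glideQ l; rewrite -jE addr0 intrD; apply; lia.
Qed.
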